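(* Let $P$ be the doubly infinite tridiagonal stochastic matrix with entries $P_{n,n+1}=a_n$, $P_{n,n}=b_n$, $P_{n,n-1}=c_n$ ($n\in\mathbb{Z}$), where $a_n+b_n+c_n=1$, $b_n\ge 0$, $0<a_n,c_n<1$ for all $n\in\mathbb{Z}$. Let $$H=1-\cfrac{a_0}{1-\cfrac{c_1}{1-\cfrac{a_1}{1-\cfrac{c_2}{1-\cdots}}}},\qquad H'=\cfrac{c_0}{1-\cfrac{a_{-1}}{1-\cfrac{c_{-1}}{1-\cfrac{a_{-2}}{1-\cdots}}}}$$ with convergents $h_n=A_n/B_n$ and $h'_{-n}=A'_{-n}/B'_{-n}$, $n\ge 0$, where $A_n,B_n,A'_{-n},B'_{-n}$ are the canonical numerators and denominators specified in the context. Assume that $$0<A_n<B_n\quad\text{and}\quad 0<A'_{-n}<B'_{-n},\qquad n\ge 1.$$ Then both continued fractions $H$ and $H'$ converge. Moreover, let $P=P_UP_L$ be the UL factorization of $P$ with free parameter $y_0$ (described in the context), and assume that $H'\le H$. Then both $P_U$ and $P_L$ are stochastic matrices if and only if $y_0$ is chosen in the range $$H'\le y_0\le H.$$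
   Context: All matrices are indexed by $\mathbb{Z}\times\mathbb{Z}$. $P$ is the transition matrix of an irreducible random walk on $\mathbb{Z}$. A matrix is stochastic if its entries are nonnegative and each row sums to $1$. Convergents. The numbers $A_n,B_n$ are given by $A_{-1}=1$, $A_0=1$, $B_{-1}=0$, $B_0=1$ and $A_{2n}=A_{2n-1}-c_nA_{2n-2}$, $B_{2n}=B_{2n-1}-c_nB_{2n-2}$ for $n\ge1$; $A_{2n+1}=A_{2n}-a_nA_{2n-1}$, $B_{2n+1}=B_{2n}-a_nB_{2n-1}$ for $n\ge0$. The numbers $A'_{-n},B'_{-n}$ are given by $A'_1=-1$, $A'_0=0$, $B'_1=0$, $B'_0=1$ and $A'_{-2n}=A'_{-2n+1}-a_{-n}A'_{-2n+2}$, $B'_{-2n}=B'_{-2n+1}-a_{-n}B'_{-2n+2}$ for $n\ge1$; $A'_{-2n-1}=A'_{-2n}-c_{-n}A'_{-2n+1}$, $B'_{-2n-1}=B'_{-2n}-c_{-n}B'_{-2n+1}$ for $n\ge0$. The values $H$ and $H'$ are the limits $\lim_{n\to\infty}h_n$ and $\lim_{n\to\infty}h'_{-n}$. UL factorization. $P_U$ is upper bidiagonal with $(P_U)_{n,n}=y_n$, $(P_U)_{n,n+1}=x_n$, and $P_L$ is lower bidiagonal with $(P_L)_{n,n}=s_n$, $(P_L)_{n,n-1}=r_n$, all other entries being $0$, where $x_n+y_n=1$ and $s_n+r_n=1$ for all $n\in\mathbb{Z}$. The identity $P=P_UP_L$ means $a_n=x_ns_{n+1}$, $b_n=x_nr_{n+1}+y_ns_n$,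 $c_n=y_nr_n$ for $n\in\mathbb{Z}$. Given the real number $y_0$, all the coefficients are computed recursively: for nonnegative indices in the order $x_0,s_1,r_1,y_1,x_1,s_2,r_2,y_2,\dots$ (i.e. $x_n=1-y_n$, $s_{n+1}=a_n/x_n$, $r_{n+1}=1-s_{n+1}$, $y_{n+1}=c_{n+1}/r_{n+1}$), and for the remaining indices in the order $r_0,s_0,x_{-1},y_{-1},r_{-1},s_{-1},\dots$ (i.e. $r_n=c_n/y_n$, $s_n=1-r_n$, $x_{n-1}=a_{n-1}/s_n$, $y_{n-1}=1-x_{n-1}$). Saying that $P_U,P_L$ are stochastic includes that all these coefficients are well defined and nonnegative. *)

(* Defs.v *)
From mathcomp Require Import all_boot all_order all_algebra.
From mathcomp Require Import all_classical all_reals all_analysis.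
From mathcomp Require Import ring lra zify.

Set Implicit Arguments.
Unset Strict Implicit.
Unset Printing Implicit Defensive.

Import Order.TTheory GRing.Theory Num.Theory.
Import numFieldNormedType.Exports.

Local Open Scope classical_set_scope.
Local Open Scope ring_scope.

Section DoublyInfiniteMatrices.
Context {R : realType}.

Definition tridiag (a b c : int -> R) (i j : int) : R :=
  if j == i + 1 then a i else
  if j == i then b i else
  if j == i - 1 then c i else 0.

Definition upper_bidiag (x y : int -> R) : int -> int -> R :=
  tridiag x y (fun=> 0).

Definition lower_bidiag (s r : int -> R) : int -> int -> R :=
  tridiag (fun=> 0) s r.

Definition stochastic (M : int -> int -> R) : Prop :=
  (forall i j, 0 <= M i j) /\
  (forall i, \esum_(j in [set: int]) (M i j)%:E = 1%:E).

(* The sum is the finitely supported one: it is the matrix product as soon as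
   every row of M has finite support, e.g. when M is bidiagonal. *)
Definition zmulmx (M N : int -> int -> R) (i j : int) : R :=
  \sum_(k \in [set: int]) M i k * N k j.

End DoublyInfiniteMatrices.

Section ContinuedFractions.
Context {R : realType}.

(* The terms of index n >= 0 of the solution of w_n = w_{n-1} - e_n w_{n-2}
   (n >= 1) with w_{-1} = u and w_0 = v. *)
Fixpoint cf_rec (e : nat -> R) (u v : R) (n : nat) : R :=
  if n is m.+1 then
    cf_rec e u v m - e n * (if m is k.+1 then cf_rec e u v k else u)
  else v.

Variables a c : int -> R.

(* Partial numerators a_0, c_1, a_1, c_2, ... and c_0, a_{-1}, c_{-1}, ...,
   numbered from 1. *)
Definition pnumH (m : nat) : R := if odd m then a m./2%:Z else c m./2%:Z.
Definition pnumH' (m : nat) : R :=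
  if odd m then c (- m./2%:Z) else a (- m./2%:Z).

Definition cf_A : nat -> R := cf_rec pnumH 1 1.
Definition cf_B : nat -> R := cf_rec pnumH 0 1.
Definition cf_h (n : nat) : R := cf_A n / cf_B n.

(* The n-th terms are the numbers A'_{-n}, B'_{-n} and h'_{-n}. *)
Definition cf_A' : nat -> R := cf_rec pnumH' (-1) 0.
Definition cf_B' : nat -> R := cf_rec pnumH' 0 1.
Definition cf_h' (n : nat) : R := cf_A' n / cf_B' n.

(* Only meaningful when cf_h, resp. cf_h', converges. *)
Definition cf_H : R := limn cf_h.
Definition cf_H' : R := limn cf_h'.

End ContinuedFractions.

Section ULFactorization.
Context {R : realType}.
Variables a b c : int -> R.
Variable y0 : R.

(* Division by 0 is total here (with value 0): the coefficients below carry
   their intended meaning only under [UL_defined]. *)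

(* y_n for n >= 0, following x_n, s_{n+1}, r_{n+1}, y_{n+1}. *)
Fixpoint UL_y_nonneg (n : nat) : R :=
  if n is m.+1 then
    let x := 1 - UL_y_nonneg m in
    let s := a m%:Z / x in
    let r := 1 - s in
    c m.+1%:Z / r
  else y0.

(* y_{-n} for n >= 0, following r_{-n}, s_{-n}, x_{-n-1}, y_{-n-1}. *)
Fixpoint UL_y_nonpos (n : nat) : R :=
  if n is m.+1 then
    let r := c (- m%:Z) / UL_y_nonpos m in
    let s := 1 - r in
    let x := a (- m.+1%:Z) / s in
    1 - x
  else y0.

Definition UL_y (n : int) : R :=
  if 0 <= n then UL_y_nonneg `|n|%N else UL_y_nonpos `|n|%N.

Definition UL_x (n : int) : R := 1 - UL_y n.

(* s_n and r_n come from x_{n-1} for n >= 1 and from y_n for n <= 0. *)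
Definition UL_s (n : int) : R :=
  if 0 < n then a (n - 1) / UL_x (n - 1) else 1 - c n / UL_y n.

Definition UL_r (n : int) : R := 1 - UL_s n.

(* No division by 0 occurs in the computation of the coefficients. *)
Definition UL_defined : Prop :=
  (forall n : int, 0 <= n -> UL_x n != 0 /\ UL_r (n + 1) != 0) /\
  (forall n : int, n <= 0 -> UL_y n != 0 /\ UL_s n != 0).

Definition P_U : int -> int -> R := upper_bidiag UL_x UL_y.
Definition P_L : int -> int -> R := lower_bidiag UL_s UL_r.

(* The second clause follows from the first one when a + b + c = 1
   (UL_defined_factorization below). *)
Definition UL_factorization : Prop :=
  UL_defined /\ (forall i j, tridiag a b c i j = zmulmx P_U P_L i j).

End ULFactorization.

Section ULFactorizationTheory.
Context {R : realType}.

Lemma zmulmx_bidiag (x y s r : int -> R) (i j : int) :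
  zmulmx (upper_bidiag x y) (lower_bidiag s r) i j =
  tridiag (fun n => x n * s (n + 1))
          (fun n => x n * r (n + 1) + y n * s n)
          (fun n => y n * r n) i j.
Proof.
rewrite /zmulmx -(fsbig_widen [set` [:: i; i + 1]] setT) //; last first.
  move=> k [_ nk] /=.
  have [ki ki1] : k != i /\ k != i + 1.
    by split; apply/eqP => ke; apply: nk; rewrite /= ke !inE eqxx ?orbT.
  rewrite /upper_bidiag /tridiag (negPf ki1) (negPf ki).
  by case: ifP; rewrite mul0r.
rewrite -fsbig_seq; last by rewrite /= andbT mem_seq1; apply/eqP; lia.
rewrite !big_cons big_nil /= addr0 /upper_bidiag /lower_bidiag /tridiag eqxx.
have -> : (i == i + 1) = false by apply/eqP; lia.
rewrite eqxx.
have [->|ji1] := eqVneq j (i + 1).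
  have -> : (i + 1 == i + 1 + 1) = false by apply/eqP; lia.
  by rewrite mulr0 add0r.
have [->|ji] := eqVneq j i.
  have -> : (i == i + 1 + 1) = false by apply/eqP; lia.
  have -> : (i == i + 1 - 1) = true by apply/eqP; lia.
  by rewrite addrC.
have -> : (j == i + 1 - 1) = false by apply/eqP; move/eqP: ji; lia.
by case: ifP => _; case: ifP => _; rewrite ?mulr0 ?addr0.
Qed.

Lemma UL_yS (a c : int -> R) (y0 : R) (n : int) : 0 <= n ->
  UL_y a c y0 (n + 1) = c (n + 1) / UL_r a c y0 (n + 1).
Proof.
case: n => // n _; rewrite /UL_r /UL_s /UL_x.
have -> : Posz n + 1 = n.+1%:Z by lia.
have -> : n.+1%:Z - 1 = n by lia.
by [].
Qed.

Lemma UL_yP (a c : int -> R) (y0 : R) (n : int) : n <= 0 ->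
  UL_y a c y0 (n - 1) = 1 - a (n - 1) / UL_s a c y0 n.
Proof.
move=> n0; have [m ->] : exists m : nat, n = - m%:Z.
  by exists `|n|%N; lia.
have -> : - m%:Z - 1 = - m.+1%:Z by lia.
have yE k : UL_y a c y0 (- k%:Z) = UL_y_nonpos a c y0 k.
  rewrite /UL_y abszN absz_nat; case: k => [|k]; first by rewrite oppr0.
  by have -> : (0 <= - k.+1%:Z) = false by lia.
rewrite /UL_s ifN; last by rewrite -leNgt; lia.
by rewrite !yE.
Qed.

Lemma UL_defined_factorization (a b c : int -> R) (y0 : R) :
  (forall n, a n + b n + c n = 1) ->
  UL_defined a c y0 -> UL_factorization a b c y0.
Proof.
move=> abc def; split=> // i j; rewrite zmulmx_bidiag.
have [defp defn] := def.
have Ea n : UL_x a c y0 n * UL_s a c y0 (n + 1) = a n.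
  have [n0|n0] := lerP 0 n.
    have [x0 _] := defp _ n0.
    rewrite /UL_s ifT; last by lia.
    by rewrite addrK mulrC divfK.
  have n10 : n + 1 <= 0 by lia.
  have [_ s0] := defn _ n10.
  have := UL_yP a c y0 n10; rewrite addrK /UL_x => ->.
  by rewrite opprB addrC subrK divfK.
have Ec n : UL_y a c y0 n * UL_r a c y0 n = c n.
  have [n0|n0] := ltrP 0 n.
    have n10 : 0 <= n - 1 by lia.
    have [_] := defp _ n10; have := UL_yS a c y0 n10.
    by rewrite subrK => -> r0; rewrite divfK.
  have [yn0 _] := defn _ n0.
  rewrite /UL_r /UL_s ifN; last by rewrite -leNgt.
  by rewrite opprB addrC subrK mulrC divfK.
have Eb n : UL_x a c y0 n * UL_r a c y0 (n + 1) + UL_y a c y0 n * UL_s a c y0 n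
    = b n.
  have -> : b n = 1 - a n - c n by rewrite -(abc n); ring.
  by rewrite -(Ea n) -(Ec n) /UL_r /UL_x; ring.
by rewrite /tridiag Ea Eb Ec.
Qed.

End ULFactorizationTheory.

(* Main.v *)
(** Both factors are stochastic exactly when the two chains of denominators
    [x_0, r_1, x_1, r_2, ...] and [y_0, s_0, y_{-1}, s_{-1}, ...] are positive.
    Each chain satisfies [t_n = 1 - e_n / t_{n-1}], so [t_n = w_n / w_{n-1}] for
    the solution [w] of [w_n = w_{n-1} - e_n w_{n-2}] with [w_{-1} = 1] and
    [w_0 = t_0].  By linearity [w_n] is [A_n - y_0 B_n], resp.
    [y_0 B'_{-n} - A'_{-n}], so positivity says that [h'_{-n} < y_0 < h_n] for
    all [n].  By the determinant identity [h_n] is strictly decreasing and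
    [h'_{-n}] strictly increasing, hence these strict bounds amount to
    [H' <= y_0 <= H]. *)

Require Import Defs.
From mathcomp Require Import all_boot all_order all_algebra.
From mathcomp Require Import all_classical all_reals all_analysis.
From mathcomp Require Import ring lra zify.
Import Order.TTheory GRing.Theory Num.Theory.
Import numFieldNormedType.Exports.
Local Open Scope classical_set_scope.
Local Open Scope ring_scope.

Lemma stochastic_tridiag (R : realType) (a b c : int -> R) :
  stochastic (tridiag a b c) <->
  forall i, [/\ 0 <= a i, 0 <= b i, 0 <= c i & a i + b i + c i = 1].
Proof.
have Ea i : tridiag a b c i (i + 1) = a i by rewrite /tridiag eqxx.
have Eb i : tridiag a b c i i = b i.
  by rewrite /tridiag eqxx ifF //; apply/eqP; lia.
have Ec i : tridiag a b c i (i - 1) = c i.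
  by rewrite /tridiag eqxx !ifF //; apply/eqP; lia.
(* Nonnegative entries let the [\esum] over the three-point support be read as a finite sum. *)
have sumE : (forall i j, 0 <= tridiag a b c i j) -> forall i,
    (\esum_(j in [set: int]) (tridiag a b c i j)%:E = (a i + b i + c i)%:E)%E.
  move=> M0 i.
  have -> : (\esum_(j in [set: int]) (tridiag a b c i j)%:E =
     \esum_(j in [set` [:: i + 1; i; i - 1]%R]) (tridiag a b c i j)%:E)%E.
    rewrite [RHS]esum_mkcond; apply: eq_esum => j _; case: ifPn => // nj.
    rewrite /tridiag; do 3 (case: eqP => [ej|_];
      first by case/negP: nj; apply/mem_set; rewrite /= ej !inE eqxx ?orbT).
    by [].
  rewrite esum_fset; [|exact: finite_seq|by move=> j _; rewrite lee_fin].
  rewrite -fsbig_seq; last first.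
    rewrite /= !inE andbT negb_or.
    by apply/andP; split; first apply/andP; first split; apply/eqP; lia.
  by rewrite !big_cons big_nil Ea Eb Ec /= -!EFinD addr0 addrA.
split=> [[M0 M1] i|abc].
  have [] := (M0 i (i + 1), M0 i i, M0 i (i - 1)); rewrite Ea Eb Ec.
  by case=> ? ? ?; split=> //; have := M1 i; rewrite sumE // => -[].
have M0 i j : 0 <= tridiag a b c i j.
  by have [? ? ? _] := abc i; rewrite /tridiag; do 3 case: ifP => // _.
by split=> // i; rewrite sumE //; have [_ _ _ ->] := abc i.
Qed.

Section ContinuedFraction.
Context {R : realType}.
Implicit Types (e t : nat -> R) (u v y k : R).

Lemma cf_rec_linear e k u v u' v' n :
  cf_rec e (u + k * u') (v + k * v') n =
  cf_rec e u v n + k * cf_rec e u' v' n.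
Proof.
(* The recurrence has depth two, so the induction carries two consecutive indices. *)
suff [] : cf_rec e (u + k * u') (v + k * v') n =
    cf_rec e u v n + k * cf_rec e u' v' n /\
  cf_rec e (u + k * u') (v + k * v') n.+1 =
    cf_rec e u v n.+1 + k * cf_rec e u' v' n.+1 by [].
elim: n => [|n [IH IHS]]; first by split => //=; ring.
split=> //; rewrite [LHS]/= [in RHS]/= -/(cf_rec _ _ _ n.+1).
by move: IHS => /= ->; rewrite IH; ring.
Qed.

(** Casoratian of two solutions: passing from index [n] to [n.+1] multiplies it by [e n.+2]. *)
Lemma cf_rec_det e u v u' v' n :
  cf_rec e u v n.+1 * cf_rec e u' v' n - cf_rec e u v n * cf_rec e u' v' n.+1 =
  \prod_(1 <= i < n.+2) e i * (v * u' - u * v').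
Proof.
elim: n => [|n IH]; first by rewrite big_nat1 /=; ring.
rewrite big_nat_recr //= mulrAC -IH /=; ring.
Qed.

(** Division is total, so the relation $w_n = t_n w_{n-1}$ is propagated only past a nonzero [t n].
    Both directions therefore prove it together with positivity. *)
Lemma cf_rec_ratio_gt0 e t : (forall n, t n.+1 = 1 - e n.+1 / t n) ->
  (forall n, 0 < t n) <-> (forall n, 0 < cf_rec e 1 (t 0%N) n).
Proof.
move=> tS; pose w n := cf_rec e 1 (t 0%N) n.
(* [w1 n] is $w_{n-1}$, including $w_{-1} = 1$. *)
pose w1 n := if n is m.+1 then w m else 1.
have wS n : t n != 0 -> w n = t n * w1 n -> w n.+1 = t n.+1 * w1 n.+1.
  move=> tn0 wn; have -> : w n.+1 = w n - e n.+1 * w1 n by [].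
  have -> : w1 n = w n / t n by rewrite wn mulrC mulKf.
  by rewrite tS /=; ring.
have w0 : w 0%N = t 0%N * w1 0%N by rewrite mulr1.
split=> [t0 n|wgt0 n].
  suff [] : 0 < w n /\ w n = t n * w1 n by [].
  elim: n => [|n [wn IH]]; first by split=> //; exact: t0.
  have E := wS n (lt0r_neq0 (t0 n)) IH.
  by split=> //; rewrite E mulr_gt0.
suff [] : 0 < t n /\ w n = t n * w1 n by [].
elim: n => [|n [tn IH]]; first by split=> //; exact: wgt0 0%N.
have E := wS n (lt0r_neq0 tn) IH.
by split=> //; rewrite -(pmulr_lgt0 _ (wgt0 n)) -[cf_rec _ _ _ n]/(w1 n.+1) -E;
  exact: wgt0.
Qed.

Lemma decreasing_cvgn_lt (h : nat -> R) (m : R) :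
  (forall n, h n.+1 < h n) -> (forall n, m <= h n) ->
  cvgn h /\ forall y, (forall n, y < h n) <-> y <= limn h.
Proof.
move=> hS mh.
have hd : nonincreasing_seq h by apply/nonincreasing_seqP => n; exact/ltW.
have hc : cvgn h.
  by apply: nonincreasing_is_cvgn => //; exists m => _ [n _ <-].
split=> // y; split=> [yh|yl n].
  by apply: limr_ge => //; near=> n; exact/ltW.
(* Strictness survives [y = limn h] because the limit is at most [h n.+1], which is below [h n]. *)
by apply: le_lt_trans (hS n); apply: le_trans yl (nonincreasing_cvgn_ge _ _ _).
Unshelve. all: by end_near. Qed.

(** Serves both fractions: [k = 1] gives $h_n$, and [k = 0] gives $-h'_{-n}$, which is also
    decreasing. *)
Lemma cf_rec_lim e k m :
  (forall n, 0 < e n.+1) -> (forall n, 0 < cf_rec e 0 1 n) ->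
  (forall n, m <= cf_rec e 1 k n / cf_rec e 0 1 n) ->
  let h n := cf_rec e 1 k n / cf_rec e 0 1 n in
  cvgn h /\ forall y, (forall n, 0 < cf_rec e 1 (k - y) n) <-> y <= limn h.
Proof.
move=> e0 B0 mh h.
have hS n : h n.+1 < h n.
  (* The initial data $(1,k)$ and $(0,1)$ contribute the factor $-1$ whatever [k] is. *)
  rewrite /h ltr_pdivrMr // mulrAC ltr_pdivlMr // -subr_lt0 cf_rec_det.
  rewrite mulr0 mulr1 sub0r mulrN1 oppr_lt0 big_add1 /=.
  by apply: prodr_gt0 => i _.
have [hc hl] := decreasing_cvgn_lt h m hS mh.
split=> // y; rewrite -hl.
have wE n : cf_rec e 1 (k - y) n = cf_rec e 1 k n - y * cf_rec e 0 1 n.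
  have := cf_rec_linear e (- y) 1 k 0 1 n.
  by rewrite mulr0 addr0 mulr1 mulNr.
by split=> H n; have := H n; rewrite wE subr_gt0 /h ltr_pdivlMr.
Qed.

End ContinuedFraction.

Section ULPositivity.
Context {R : realType}.
Variables a c : int -> R.
Hypothesis a_gt0 : forall n, 0 < a n.
Hypothesis c_gt0 : forall n, 0 < c n.

Lemma pnumH_gt0 n : 0 < pnumH a c n.
Proof. by rewrite /pnumH; case: ifP. Qed.

Lemma pnumH'_gt0 n : 0 < pnumH' a c n.
Proof. by rewrite /pnumH'; case: ifP. Qed.

Lemma UL_nonneg_gt0 y0 :
  (forall n : int, 0 <= n -> 0 < UL_x a c y0 n /\ 0 < UL_r a c y0 (n + 1)) <->
  (forall n, 0 < cf_rec (pnumH a c) 1 (1 - y0) n).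
Proof.
(* The interleaving $x_0, r_1, x_1, r_2, \dots$ matches the partial numerators $a_0, c_1, a_1,
   \dots$ of [pnumH]. *)
pose t n := if odd n then UL_r a c y0 (n./2%:Z + 1) else UL_x a c y0 n./2%:Z.
rewrite -[1 - y0]/(t 0%N) -cf_rec_ratio_gt0.
  split=> [xr n|t0 [n|//] _].
    by rewrite /t; case: ifP => _; have [] := xr n./2%:Z isT.
  have := t0 n.*2; have := t0 n.*2.+1.
  by rewrite /t /= odd_double /= uphalf_double doubleK.
move=> n; rewrite /t /pnumH /= uphalf_half.
case: (odd n) => /=; last first.
  by rewrite add0n /UL_r /UL_s ifT; [rewrite addrK | lia].
have -> : Posz (1 + n./2) = n./2%:Z + 1 by lia.
by rewrite /UL_x UL_yS.
Qed.

Lemma UL_nonpos_gt0 y0 :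
  (forall n : int, n <= 0 -> 0 < UL_y a c y0 n /\ 0 < UL_s a c y0 n) <->
  (forall n, 0 < cf_rec (pnumH' a c) 1 y0 n).
Proof.
(* Here the chain is $y_0, s_0, y_{-1}, s_{-1}, \dots$, with numerators $c_0, a_{-1}, c_{-1},
   \dots$. *)
pose t n := if odd n then UL_s a c y0 (- n./2%:Z) else UL_y a c y0 (- n./2%:Z).
have t00 : t 0%N = y0 by rewrite /t /= oppr0.
rewrite -{3}t00 -cf_rec_ratio_gt0.
  split=> [ys n|t0 n n0].
    by rewrite /t; case: ifP => _; have [] := ys (- n./2%:Z) ltac:(lia).
  have := t0 `|n|%N.*2; have := t0 `|n|%N.*2.+1.
  rewrite /t /= odd_double /= uphalf_double doubleK.
  by have -> : - `|n|%N%:Z = n by lia.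
move=> n; rewrite /t /pnumH' /= uphalf_half.
case: (odd n) => /=; last first.
  by rewrite add0n /UL_s ifN //; rewrite -leNgt; lia.
have -> : - Posz (1 + n./2) = - n./2%:Z - 1 by lia.
by rewrite UL_yP //; lia.
Qed.

(** Stochasticity gives only nonnegativity; [UL_defined] excludes zero. Conversely, each coefficient
    outside the two chains is a quotient of some [a] or [c] by a positive chain element. *)
Lemma UL_stochastic_gt0 b y0 : (forall n, a n + b n + c n = 1) ->
  [/\ UL_factorization a b c y0,
      stochastic (P_U a c y0) & stochastic (P_L a c y0)] <->
  (forall n : int, 0 <= n -> 0 < UL_x a c y0 n /\ 0 < UL_r a c y0 (n + 1)) /\
  (forall n : int, n <= 0 -> 0 < UL_y a c y0 n /\ 0 < UL_s a c y0 n).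
Proof.
move=> abc; split=> [[[[xr ys] _]]|[xr ys]].
  move=> /stochastic_tridiag U /stochastic_tridiag L.
  split=> n n0.
    have [xn0 rn0] := xr n n0; have [x0 _ _ _] := U n.
    by have [_ _ r0 _] := L (n + 1); rewrite !lt0r xn0 rn0.
  have [yn0 sn0] := ys n n0; have [_ y0' _ _] := U n.
  by have [_ s0 _ _] := L n; rewrite !lt0r yn0 sn0.
have x0 n : 0 < UL_x a c y0 n.
  have [/xr[]//|n0] := lerP 0 n.
  have n1 : n + 1 <= 0 by lia.
  have [_ s0] := ys _ n1.
  have := UL_yP a c y0 n1; rewrite addrK /UL_x => ->.
  by rewrite opprB addrC subrK divr_gt0.
have y0' n : 0 < UL_y a c y0 n.
  have [/ys[]//|n0] := lerP n 0.
  have n1 : 0 <= n - 1 by lia.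
  have := UL_yS a c y0 n1; have [_] := xr _ n1.
  by rewrite subrK => r0 ->; rewrite divr_gt0.
have s0 n : 0 < UL_s a c y0 n.
  have [/ys[]//|n0] := lerP n 0.
  by rewrite /UL_s n0 divr_gt0.
have r0 n : 0 < UL_r a c y0 n.
  have [n0|n0] := lerP n 0; last first.
    have n1 : 0 <= n - 1 by lia.
    by have [_] := xr _ n1; rewrite subrK.
  rewrite /UL_r /UL_s ifN; last by rewrite -leNgt.
  by rewrite opprB addrC subrK divr_gt0.
split.
- by apply: UL_defined_factorization => //; split=> n _; rewrite !lt0r_neq0.
- apply/stochastic_tridiag => i; split=> //; [exact/ltW | exact/ltW|].
  by rewrite addr0 /UL_x subrK.
- apply/stochastic_tridiag => i; split=> //; [exact/ltW | exact/ltW|].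
  by rewrite add0r /UL_r addrC subrK.
Qed.

End ULPositivity.

Theorem theorem2p1 (R : realType) (a b c : int -> R)
  (abc_sum : forall n : int, a n + b n + c n = 1)
  (b_ge0 : forall n : int, 0 <= b n)
  (a_bnd : forall n : int, 0 < a n < 1)
  (c_bnd : forall n : int, 0 < c n < 1)
  (AB : forall n : nat, (1 <= n)%N -> 0 < cf_A a c n < cf_B a c n)
  (AB' : forall n : nat, (1 <= n)%N -> 0 < cf_A' a c n < cf_B' a c n) :
  (cvgn (cf_h a c) /\ cvgn (cf_h' a c)) /\
  (cf_H' a c <= cf_H a c ->
   forall y0 : R,
     [/\ UL_factorization a b c y0,
         stochastic (P_U a c y0) & stochastic (P_L a c y0)]
     <-> cf_H' a c <= y0 <= cf_H a c).
Proof.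
have a0 n : 0 < a n by have /andP[] := a_bnd n.
have c0 n : 0 < c n by have /andP[] := c_bnd n.
have B0 n : 0 < cf_B a c n.
  by case: n => [|n] //; have /andP[/lt_trans] := AB n.+1 isT; apply.
have B'0 n : 0 < cf_B' a c n.
  by case: n => [|n] //; have /andP[/lt_trans] := AB' n.+1 isT; apply.
have h_ge0 n : 0 <= cf_h a c n.
  rewrite /cf_h divr_ge0 ?(ltW (B0 n)) //.
  by case: n => [|n] //; have /andP[/ltW] := AB n.+1 isT.
have [hc hP] := cf_rec_lim _ _ _ (fun n => pnumH_gt0 _ _ a0 c0 n.+1) B0 h_ge0.
(* The data $(-1,0)$ of $A'$ are negated to fit the form $(1,k)$ with $k = 0$. *)
have A'N n : cf_rec (pnumH' a c) 1 0 n = - cf_A' a c n.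
  have := cf_rec_linear (pnumH' a c) (-1) 0 0 (-1) 0 n.
  have z : cf_rec (pnumH' a c) 0 0 n = 0.
    by have := cf_rec_linear (pnumH' a c) (-1) 0 0 0 0 n;
      rewrite !mulr0 addr0 mulN1r subrr.
  by rewrite z !add0r !mulN1r opprK oppr0.
have h'N : (fun n => cf_rec (pnumH' a c) 1 0 n / cf_rec (pnumH' a c) 0 1 n) =
    (fun n => - cf_h' a c n).
  by apply/funext => n; rewrite A'N mulNr.
(* The lower bound $-1$ for $-h'_{-n}$ comes from $A'_{-n} < B'_{-n}$. *)
have h'_le1 n : -1 <= cf_rec (pnumH' a c) 1 0 n / cf_rec (pnumH' a c) 0 1 n.
  rewrite A'N mulNr lerN2 ler_pdivrMr ?B'0 // mul1r.
  by case: n => [|n] //; have /andP[_ /ltW] := AB' n.+1 isT.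
have [] := cf_rec_lim _ _ _ (fun n => pnumH'_gt0 _ _ a0 c0 n.+1) B'0 h'_le1.
rewrite h'N is_cvgNE => h'c h'P.
split=> // _ y0.
rewrite UL_stochastic_gt0 // UL_nonneg_gt0 UL_nonpos_gt0.
rewrite hP.
(* At $-y_0$ the initial value $k - y$ becomes $y_0$, and the condition $-y_0 \le -H'$ becomes $H'
   \le y_0$. *)
have := h'P (- y0); rewrite sub0r opprK => ->.
rewrite limN // lerN2.
by split=> [[-> ->]|/andP[-> ->]].
Qed.
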